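(* Let $A$ be a torsion-free abelian group, $(A,(\cdot,\cdot),R)$ a tame irreducible affine reflection system of type $A_1$, and $\Pi\subseteq R^\times$ a reflectable set for $R$. Then the hyperbolic Weyl group $\widetilde{\mathcal{W}}$ of $R$ is isomorphic to the group $G$ defined by generators: $y_\alpha$, $\alpha\in\Pi$; relations: $y_{\alpha_1}\cdots y_{\alpha_k}=1$ for all $(\alpha_1,\ldots,\alpha_k)\in\widetilde{\mathrm{Alt}}(\Pi)$.
   Context: Let $A$ be a torsion-free abelian group with a nontrivial symmetric positive semidefinite bi-homomorphism $(\cdot,\cdot):A\times A\to\mathbb{Q}$, with radical $A^0=\{\alpha\in A:(\alpha,A)=0\}$. For $B\subseteq A$ put $B^\times=B\setminus A^0$, $B^0=B\cap A^0$. Put $(\beta,\alpha^\vee)=2(\beta,\alpha)/(\alpha,\alpha)$ if $(\alpha,\alpha)\neq0$ and $(\beta,\alpha^\vee)=0$ otherwise. A subset $R\subseteq A$ is an affine reflection system if (R1) $R=-R$; (R2) $R$ generates $A$; (R3) for $\alpha\in R^\times$, $\beta\in R$ there are $d,u\in\mathbb{Z}_{\ge0}$ with $(\beta+\mathbb{Z}\alpha)\cap R=\{\beta-d\alpha,\dots,\beta+u\alpha\}$ and $d-u=(\beta,\alpha^\vee)$. It is irreducible if $R^\times$ is not a disjoint union of two nonempty orthogonal subsets, and tame if $R^0\subseteq R^\times-R^\times$. Its type is the type of its image in $A/A^0$ (a locally finite root system); type $A_1$ means that this image is $\{0,\pm\bar\epsilon\}$. For $R$ tame irreducible of type $A_1$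 it is known that $R=(S+S)\cup(\dot R+S)$ with $\dot R=\{0,\pm\epsilon\}$, $S\subseteq R^0$, $0\in S$, $S\pm2S\subseteq S$, $\langle S\rangle=A^0$, and $A=\mathbb{Z}\epsilon\oplus A^0$. Fix such $\epsilon$, $S$, normalized so that $(\epsilon,\epsilon)=2$. The Weyl group $\mathcal{W}$ of $R$ is the subgroup of $\mathrm{Aut}(A)$ generated by all $w_\alpha(\beta)=\beta-(\beta,\alpha^\vee)\alpha$, $\alpha\in R$; for $P\subseteq R$, $\mathcal{W}_P$ is the subgroup generated by $w_\alpha$, $\alpha\in P$. A set $P\subseteq R^\times$ is a reflectable set if $\mathcal{W}_PP=R^\times$. Let $\mathcal{V}=\mathbb{Q}\otimes_{\mathbb{Z}}A$ with the extended form; identify $A$, $R$ with subsets of $\mathcal{V}$. Let $\mathcal{V}^0=\mathbb{Q}\otimes A^0$, so $\mathcal{V}=\mathbb{Q}\epsilon\oplus\mathcal{V}^0$. Fix a basis $\{\sigma_j\mid j\in J\}\subseteq S$ of $\mathcal{V}^0$; let $\lambda_j\in(\mathcal{V}^0)^\star$ be given by $\lambda_j(\sigma_i)=\delta_{ij}$, and $(\mathcal{V}^0)^\dagger=\sum_{j\in J}\mathbb{Q}\lambda_j$. Put $\widetilde{\mathcal{V}}=\mathcal{V}\oplus(\mathcal{V}^0)^\dagger$ and extend the form to a symmetric bilinear form on $\widetilde{\mathcal V}$ by $(\epsilon,(\mathcal{V}^0)^\dagger)=((\mathcal{V}^0)^\dagger,(\mathcal{V}^0)^\dagger)=0$ and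 $(\sigma,\lambda)=\lambda(\sigma)$ for $\sigma\in\mathcal{V}^0$, $\lambda\in(\mathcal{V}^0)^\dagger$. For $\alpha\in\mathcal{V}$ let $w_\alpha\in\mathrm{Aut}(\widetilde{\mathcal{V}})$, $w_\alpha(\beta)=\beta-(\beta,\alpha^\vee)\alpha$ (same convention for $\alpha^\vee$). The hyperbolic Weyl group $\widetilde{\mathcal{W}}$ of $R$ is the subgroup of $\mathrm{Aut}(\widetilde{\mathcal{V}})$ generated by $w_\alpha$, $\alpha\in R$. For $\alpha\in A$ write $\alpha=\mathrm{sgn}(\alpha)\epsilon+p(\alpha)$ with $\mathrm{sgn}(\alpha)\in\mathbb{Z}$, $p(\alpha)\in A^0$, and $p(\alpha)=\sum_{j\in J}p_j(\alpha)\sigma_j$ with $p_j(\alpha)\in\mathbb{Q}$. For $P\subseteq R^\times$, a hyper-alternating $k$-tuple in $P$ is a tuple $(\alpha_1,\dots,\alpha_k)$ of elements of $P$ with $k$ even such that for all $j\in J$: $$\sum_{i=1}^k(-1)^i\mathrm{sgn}(\alpha_i)p_j(\alpha_i)=0$$ and $$\sum_{s=1}^kp_j(\alpha_s)p(\alpha_s)+2\sum_{s=2}^k(-1)^sp_j(\alpha_s)\mathrm{sgn}(\alpha_s)\sum_{r=1}^{s-1}(-1)^r\mathrm{sgn}(\alpha_r)p(\alpha_r)=0.$$ $\widetilde{\mathrm{Alt}}(P)$ is the set of all hyper-alternating $k$-tuples in $P$, for all $k$. *)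

(* Defs.v *)
From HB Require Import structures.
From mathcomp Require Import all_boot all_order all_algebra.
From mathcomp Require Import zify.
From mathcomp Require Import boolp classical_sets functions cardinality fsbigop.

Set Implicit Arguments.
Unset Strict Implicit.
Unset Printing Implicit Defensive.

Import Order.TTheory GRing.Theory Num.Theory.

Local Open Scope classical_set_scope.
Local Open Scope ring_scope.
Local Open Scope quotient_scope.

Definition torsion_free (A : zmodType) : Prop :=
  forall (a : A) (n : nat), (0 < n)%N -> a *+ n = 0 -> a = 0.

(* Q ⊗ A is realized as the localization of the Z-module A at the nonzero
   integers: the pair (a, n) stands for the fraction a / n.+1. *)
Section Rationalization.
Variable A : zmodType.

Definition qfrac_eq (x y : A * nat) : bool :=
  `[< exists k : nat, x.1 *+ (y.2.+1 * k.+1) = y.1 *+ (x.2.+1 * k.+1) >].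

Lemma qfrac_eq_refl : reflexive qfrac_eq.
Proof. by move=> x; apply/asboolP; exists 0%N. Qed.

Lemma qfrac_eq_sym : symmetric qfrac_eq.
Proof. by move=> x y; apply/asboolP/asboolP => -[k e]; exists k. Qed.

Let posS (n : nat) : (0 < n)%N -> exists m, m.+1 = n.
Proof. by case: n => // n _; exists n. Qed.

Lemma qfrac_eq_trans : transitive qfrac_eq.
Proof.
move=> [b m] [a n] [c p] /asboolP[/= k exy] /asboolP[/= l eyz].
apply/asboolP; have [j jE] := @posS (m.+1 * k.+1 * l.+1) isT.
exists j => /=; rewrite jE.
transitivity (a *+ (m.+1 * k.+1) *+ (p.+1 * l.+1)).
  by rewrite -mulrnA; congr (_ *+ _); lia.
transitivity (b *+ (p.+1 * l.+1) *+ (n.+1 * k.+1)).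
  by rewrite exy -!mulrnA mulnC.
by rewrite eyz -mulrnA; congr (_ *+ _); lia.
Qed.

Canonical qfrac_equiv :=
  EquivRel qfrac_eq qfrac_eq_refl qfrac_eq_sym qfrac_eq_trans.

Definition rationalization := {eq_quot qfrac_eq}.
HB.instance Definition _ : EqQuotient _ qfrac_eq rationalization :=
  EqQuotient.on rationalization.
HB.instance Definition _ := Choice.on rationalization.

Definition qfrac (a : A) (n : nat) : rationalization := \pi_(rationalization) (a, n.-1).

Arguments qfrac : simpl never.

Lemma qfracP a b n m : (0 < n)%N -> (0 < m)%N ->
  qfrac a n = qfrac b m <->
  exists k : nat, a *+ (m * k.+1) = b *+ (n * k.+1).
Proof.
move=> n0 m0; split; first by move=> /eqmodP/asboolP[/= k]; rewrite !prednK//; exists k.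
by move=> [k e]; apply/eqmodP/asboolP; exists k; rewrite /= !prednK.
Qed.

Lemma qfracW (x : rationalization) : exists a n, x = qfrac a n.+1.
Proof. by exists (repr x).1, (repr x).2; rewrite /qfrac /= -surjective_pairing reprK. Qed.

Lemma qfracMn a n k : (0 < n)%N -> (0 < k)%N ->
  qfrac (a *+ k) (n * k) = qfrac a n.
Proof.
move=> n0 k0; apply/qfracP => //; first by rewrite muln_gt0 n0.
by exists 0%N; rewrite -mulrnA; congr (_ *+ _); lia.
Qed.

Definition qfrac_opp (x : rationalization) :=
  qfrac (- (repr x).1) (repr x).2.+1.

Definition qfrac_add (x y : rationalization) :=
  let: (a, n) := repr x in let: (b, m) := repr y in
  qfrac (a *+ m.+1 + b *+ n.+1) (n.+1 * m.+1).

Definition qfrac_scale (q : rat) (x : rationalization) :=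
  qfrac ((repr x).1 *~ numq q) ((repr x).2.+1 * `|denq q|).

Lemma qfrac_repr a n : (0 < n)%N ->
  exists k, a *+ ((repr (qfrac a n)).2.+1 * k.+1)
            = (repr (qfrac a n)).1 *+ (n * k.+1).
Proof.
move=> n0; have : qfrac a n = qfrac (repr (qfrac a n)).1 (repr (qfrac a n)).2.+1.
  by rewrite [RHS]/qfrac /= -surjective_pairing reprK.
by move/qfracP; apply.
Qed.

Lemma qfrac_oppE a n : (0 < n)%N -> qfrac_opp (qfrac a n) = qfrac (- a) n.
Proof.
move=> n0; have [k e] := qfrac_repr a n0.
by apply/qfracP => //; exists k; rewrite !mulNrn e.
Qed.

Lemma qfrac_addE a b n m : (0 < n)%N -> (0 < m)%N ->
  qfrac_add (qfrac a n) (qfrac b m) = qfrac (a *+ m + b *+ n) (n * m).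
Proof.
move=> n0 m0; rewrite /qfrac_add.
have [k] := qfrac_repr a n0; have [l] := qfrac_repr b m0.
case: (repr (qfrac a n)) (repr (qfrac b m)) => [a' n'] [b' m'] /= eb ea.
apply/qfracP; rewrite ?muln_gt0 ?n0//.
have [j jE] := @posS (k.+1 * l.+1) isT; exists j; rewrite jE.
rewrite !mulrnDl; congr (_ + _).
  transitivity (a' *+ (n * k.+1) *+ (m'.+1 * m * l.+1)).
    by rewrite -!mulrnA; congr (_ *+ _); lia.
  by rewrite -ea -!mulrnA; congr (_ *+ _); lia.
transitivity (b' *+ (m * l.+1) *+ (n'.+1 * n * k.+1)).
  by rewrite -!mulrnA; congr (_ *+ _); lia.
by rewrite -eb -!mulrnA; congr (_ *+ _); lia.
Qed.

Lemma qfrac_scaleE (q : rat) (z : int) (d : nat) a n :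
  (0 < n)%N -> (0 < d)%N -> q = z%:~R / d%:R ->
  qfrac_scale q (qfrac a n) = qfrac (a *~ z) (n * d).
Proof.
move=> n0 d0 qE; rewrite /qfrac_scale.
have [k] := qfrac_repr a n0; case: (repr _) => [a' n'] /= e.
have dq0 : (0 < `|denq q|)%N by rewrite absz_gt0 denq_neq0.
have ezd : numq q * d%:Z = z * `|denq q|%N%:Z.
  apply: (@intr_inj rat); rewrite !intrM absz_denq numqE qE -!mulrA.
  rewrite [_ * d%:~R]mulrC mulrA.
  by rewrite -[d%:~R]/(d%:R) mulrA divfK ?pnatr_eq0 -?lt0n.
apply/qfracP; rewrite ?muln_gt0 ?n0//.
exists k; rewrite !pmulrn -!mulrzA.
transitivity (a' *~ (n * k.+1)%N *~ (numq q * d%:Z)).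
  by rewrite -!mulrzA; congr (_ *~ _); lia.
rewrite -pmulrn -e ezd pmulrn -!mulrzA; congr (_ *~ _); lia.
Qed.

Lemma qfrac_addA : associative qfrac_add.
Proof.
move=> x y z; have [a [n ->]] := qfracW x.
have [b [m ->]] := qfracW y; have [c [p ->]] := qfracW z.
rewrite !qfrac_addE// mulnA !mulrnDl -!mulrnA addrA.
by congr (qfrac (_ + _ + _) _); congr (_ *+ _); lia.
Qed.

Lemma qfrac_addC : commutative qfrac_add.
Proof.
move=> x y; have [a [n ->]] := qfracW x; have [b [m ->]] := qfracW y.
by rewrite !qfrac_addE// addrC mulnC.
Qed.

Lemma qfrac_add0 : left_id (qfrac 0 1) qfrac_add.
Proof.
by move=> x; have [a [n ->]] := qfracW x; rewrite qfrac_addE// mul0rn add0r mul1n.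
Qed.

Lemma qfrac_addN : left_inverse (qfrac 0 1) qfrac_opp qfrac_add.
Proof.
move=> x; have [a [n ->]] := qfracW x.
rewrite qfrac_oppE// qfrac_addE// mulNrn addNr.
by apply/qfracP => //; exists 0%N; rewrite !mul0rn.
Qed.

HB.instance Definition _ := GRing.isZmodule.Build rationalization
  qfrac_addA qfrac_addC qfrac_add0 qfrac_addN.

Let rat_frac (q : rat) : exists z d, (0 < d)%N /\ q = z%:~R / d%:R.
Proof.
exists (numq q), `|denq q|%N; split; first by rewrite absz_gt0 denq_neq0.
by rewrite pmulrn absz_denq divq_num_den.
Qed.

Lemma qfrac_scaleA (q r : rat) x :
  qfrac_scale q (qfrac_scale r x) = qfrac_scale (q * r) x.
Proof.
have [z [d [d0 qE]]] := rat_frac q; have [t [e [e0 rE]]] := rat_frac r.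
have [a [n ->]] := qfracW x.
have qrE : q * r = (z * t)%:~R / (d * e)%:R.
  by rewrite qE rE natrM intrM invfM mulrACA.
rewrite (qfrac_scaleE _ _ _ rE)// (qfrac_scaleE _ _ _ qE) ?muln_gt0//.
rewrite (qfrac_scaleE _ _ _ qrE) ?muln_gt0 ?d0//.
by rewrite -mulrzA [(t * z)%R]mulrC; congr qfrac; lia.
Qed.

Lemma qfrac_scale1 : left_id 1 qfrac_scale.
Proof.
move=> x; have [a [n ->]] := qfracW x.
by rewrite (@qfrac_scaleE 1 1 1)// muln1.
Qed.

Lemma qfrac_scaleDr : right_distributive qfrac_scale +%R.
Proof.
move=> q x y; have [z [d [d0 qE]]] := rat_frac q.
have [a [n ->]] := qfracW x; have [b [m ->]] := qfracW y.
rewrite -[_ + _]/(qfrac_add _ _) -[RHS]/(qfrac_add _ _).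
rewrite qfrac_addE// !(qfrac_scaleE _ _ _ qE) ?qfrac_addE ?muln_gt0//.
rewrite -[LHS](@qfracMn _ _ d) ?muln_gt0//.
congr qfrac; last lia.
rewrite !pmulrn -!mulrzA mulrzDl -!mulrzA.
by congr (_ *~ _ + _ *~ _); lia.
Qed.

Lemma qfrac_scaleDl x : {morph qfrac_scale^~ x : q r / q + r}.
Proof.
move=> q r; have [z [d [d0 qE]]] := rat_frac q.
have [t [e [e0 rE]]] := rat_frac r; have [a [n ->]] := qfracW x.
have qrE : q + r = (z * e%:Z + t * d%:Z)%:~R / (d * e)%:R.
  rewrite qE rE intrD !intrM natrM -[e%:~R]/(e%:R) -[d%:~R]/(d%:R).
  by rewrite addf_div ?pnatr_eq0 -?lt0n.
rewrite -[RHS]/(qfrac_add _ _) (qfrac_scaleE _ _ _ qrE) ?muln_gt0 ?d0//.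
rewrite (qfrac_scaleE _ _ _ qE)// (qfrac_scaleE _ _ _ rE)//.
rewrite qfrac_addE ?muln_gt0// -[LHS](@qfracMn _ _ n.+1) ?muln_gt0 ?d0//.
congr qfrac; last lia.
rewrite !pmulrn -!mulrzA -mulrzDr; congr (_ *~ _); lia.
Qed.

HB.instance Definition _ := GRing.Zmodule_isLmodule.Build rat rationalization
  qfrac_scaleA qfrac_scale1 qfrac_scaleDr qfrac_scaleDl.

Definition inq (a : A) : rationalization := qfrac a 1.
Arguments inq : simpl never.

Lemma inq_is_zmod_morphism : zmod_morphism inq.
Proof.
move=> a b; rewrite -[RHS]/(qfrac_add _ (qfrac_opp _)) qfrac_oppE//.
by rewrite qfrac_addE.
Qed.

HB.instance Definition _ :=
  GRing.isZmodMorphism.Build A rationalization inq inq_is_zmod_morphism.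

Lemma inq_inj : torsion_free A -> injective inq.
Proof.
move=> tfA a b /qfracP[]// k /eqP; rewrite !mul1n -subr_eq0 -mulrnBl => /eqP.
by move=> /tfA => /(_ isT)/eqP; rewrite subr_eq0 => /eqP.
Qed.

Lemma qfracE (a : A) (n : nat) : qfrac a n.+1 = n.+1%:R^-1 *: inq a.
Proof.
rewrite -[RHS]/(qfrac_scale _ _) (@qfrac_scaleE _ 1 n.+1) ?mul1r ?mul1n//.
Qed.

(* The extension of a bi-additive f : A × A → Q to Q ⊗ A; for such f it does
   not depend on the representatives (formqE below). *)
Definition formq (f : A -> A -> rat) (x y : rationalization) : rat :=
  f (repr x).1 (repr y).1 / ((repr x).2.+1%:R * (repr y).2.+1%:R).

Lemma formqE (f : A -> A -> rat) (a b : A) (n m : nat) :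
  (forall b, zmod_morphism (f^~ b)) -> (forall a, zmod_morphism (f a)) ->
  formq f (qfrac a n.+1) (qfrac b m.+1) = f a b / (n.+1%:R * m.+1%:R).
Proof.
move=> fl fr; rewrite /formq.
pose L y := GRing.isZmodMorphism.Build _ _ _ (fl y).
pose FL y : {additive A -> rat} := HB.pack (f^~ y) (L y).
pose Rr x := GRing.isZmodMorphism.Build _ _ _ (fr x).
pose FR x : {additive A -> rat} := HB.pack (f x) (Rr x).
have fMn x y k l : f (x *+ k) (y *+ l) = f x y * (k%:R * l%:R).
  rewrite -[LHS]/(FL (y *+ l) (x *+ k)) raddfMn/= -[f x _]/(FR x (y *+ l)).
  by rewrite raddfMn/= [k%:R * _]mulrC mulrA !mulr_natr.
have [k] := @qfrac_repr a n.+1 isT; have [l] := @qfrac_repr b m.+1 isT.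
case: (repr _) => [b' m'] /= eb; case: (repr _) => [a' n'] /= ea.
have kl : k.+1%:R * l.+1%:R != 0 :> rat by rewrite mulf_neq0 ?pnatr_eq0.
have := congr2 f ea eb.
rewrite !fMn !natrM !(mulrACA _ k.+1%:R) [LHS]mulrA [RHS]mulrA => E0; have E := mulIf kl E0.
by apply/eqP; rewrite eqr_div ?mulf_neq0 ?pnatr_eq0// E.
Qed.

End Rationalization.

Section Span.
Variables (K : pzRingType) (V : lmodType K).

Definition lin_span (B : set V) : set V :=
  smallest [set U : set V | U 0 /\
    forall (c : K) u v, U u -> U v -> U (c *: u + v)] B.

Definition span_pred (B : set V) (v : V) : bool := `[< lin_span B v >].

Lemma span_pred_closed (B : set V) : submod_closed (span_pred B).
Proof.
split=> [|c u v]; first by apply/asboolP => U /= [[U0 _] _].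
rewrite !unfold_in => /asboolP Bu /asboolP Bv; apply/asboolP => U /= UB.
by have [[_ UD] _] := UB; apply: UD; [apply: Bu|apply: Bv].
Qed.

HB.instance Definition _ (B : set V) :=
  GRing.isSubmodClosed.Build K V (span_pred B) (span_pred_closed B).

Definition span_type (B : set V) := {v : V | span_pred B v}.
HB.instance Definition _ B := [isSub of span_type B for sval].
HB.instance Definition _ B := [Choice of span_type B by <:].
HB.instance Definition _ B :=
  [SubChoice_isSubLmodule of span_type B by <:].

Definition is_basis (J : choiceType) (e : J -> V) (U : set V) : Prop :=
  (forall (s : seq J) (c : J -> K), uniq s ->
     \sum_(j <- s) c j *: e j = 0 -> forall j, j \in s -> c j = 0) /\
  lin_span (range e) = U.

End Span.

(* The group Aut(M) of linear automorphisms of a module, with composition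
   (g * h) x = g (h x). *)
Section Aut.
Variables (K : pzRingType) (M : lmodType K).

Definition is_aut (g : M -> M) : bool := `[< linear g /\ bijective g >].
Definition aut := {g : M -> M | is_aut g}.
HB.instance Definition _ := [isSub of aut for sval].
HB.instance Definition _ := [Choice of aut by <:].

Definition aut_fun (g : aut) : M -> M := val g.
Coercion aut_fun : aut >-> Funclass.

Lemma autP (g h : aut) : g =1 h -> g = h.
Proof. by move=> gh; apply/val_inj/funext. Qed.

Lemma aut_linear (g : aut) : linear g.
Proof. by have /asboolP[] := valP g. Qed.

Lemma aut_bij (g : aut) : bijective g.
Proof. by have /asboolP[] := valP g. Qed.

Lemma is_aut_id : is_aut id.
Proof. by apply/asboolP; split; [move=> ?|exists id]. Qed.

Lemma is_aut_comp (g h : aut) : is_aut (g \o h).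
Proof.
apply/asboolP; split; last exact: bij_comp (aut_bij g) (aut_bij h).
by move=> c u v; rewrite /= aut_linear aut_linear.
Qed.

Lemma aut_inv_subproof (g : aut) : exists h, [/\ is_aut h, cancel g h & cancel h g].
Proof.
have [h gK hK] := aut_bij g; exists h; split=> //; apply/asboolP.
split; last by exists g.
by move=> c u v; apply: (bij_inj (aut_bij g)); rewrite aut_linear !hK.
Qed.

Definition aut_one : aut := exist _ id is_aut_id.
Definition aut_mul (g h : aut) : aut := exist _ (g \o h) (is_aut_comp g h).
Definition aut_inv (g : aut) : aut :=
  let: exist h P := cid (aut_inv_subproof g) in
  exist _ h (let: And3 hP _ _ := P in hP).

Lemma aut_invK (g : aut) : cancel g (aut_inv g) /\ cancel (aut_inv g) g.
Proof. by rewrite /aut_inv; case: cid => h []. Qed.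

Lemma aut_mulA : associative aut_mul. Proof. by move=> f g h; apply: autP. Qed.
Lemma aut_mul1 : left_id aut_one aut_mul. Proof. by move=> g; apply: autP. Qed.
Lemma aut_1mul : right_id aut_one aut_mul. Proof. by move=> g; apply: autP. Qed.
Lemma aut_mulV : left_inverse aut_one aut_inv aut_mul.
Proof. by move=> g; apply: autP; have [] := aut_invK g. Qed.
Lemma aut_Vmul : right_inverse aut_one aut_inv aut_mul.
Proof. by move=> g; apply: autP; have [] := aut_invK g. Qed.

HB.instance Definition _ :=
  isGroup.Build aut aut_mulA aut_mul1 aut_1mul aut_mulV aut_Vmul.

End Aut.

Section GeneratedSubgroup.
Variable G : groupType.

Definition gen_sub (B : set G) : set G :=
  smallest [set H : set G | H 1%g /\ forall x y, H x -> H y -> H (x / y)%g] B.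

Definition gen_pred (B : set G) (x : G) : bool := `[< gen_sub B x >].

Lemma gen_pred_closed (B : set G) : group_closed (gen_pred B).
Proof.
split=> [|x y]; first by apply/asboolP => U /= [[U1 _] _].
rewrite !unfold_in => /asboolP Bx /asboolP By; apply/asboolP => U /= UB.
by have [[_ UD] _] := UB; apply: UD; [apply: Bx|apply: By].
Qed.

Definition gen_group (B : set G) := {x : G | gen_pred B x}.
HB.instance Definition _ B := [isSub of gen_group B for sval].
HB.instance Definition _ B := [Choice of gen_group B by <:].
HB.instance Definition _ B :=
  SubChoice_isSubGroup.Build G (gen_pred B) (gen_group B) (gen_pred_closed B).

End GeneratedSubgroup.

(* The group < X | rels >. A word is a list of letters; (x, false) stands for
   the generator x and (x, true) for its inverse. *)
Section Presentation.
Variables (X : choiceType) (rels : set (seq (X * bool))).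

Definition word_inv (w : seq (X * bool)) : seq (X * bool) :=
  rev [seq (l.1, ~~ l.2) | l <- w].

Inductive word_eq : seq (X * bool) -> seq (X * bool) -> Prop :=
| word_eq_refl u : word_eq u u
| word_eq_sym u v : word_eq u v -> word_eq v u
| word_eq_trans u v w : word_eq u v -> word_eq v w -> word_eq u w
| word_eq_cat u u' v v' :
    word_eq u u' -> word_eq v v' -> word_eq (u ++ v) (u' ++ v')
| word_eq_cancel x b : word_eq [:: (x, b); (x, ~~ b)] [::]
| word_eq_rel r : rels r -> word_eq r [::].

Definition word_eqb (u v : seq (X * bool)) : bool := `[< word_eq u v >].

Lemma word_eqb_refl : reflexive word_eqb.
Proof. by move=> u; apply/asboolP; constructor. Qed.

Lemma word_eqb_sym : symmetric word_eqb.
Proof. by move=> u v; apply/asboolP/asboolP => uv; exact: word_eq_sym. Qed.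

Lemma word_eqb_trans : transitive word_eqb.
Proof.
move=> v u w /asboolP uv /asboolP vw; apply/asboolP; exact: word_eq_trans vw.
Qed.

Canonical word_equiv :=
  EquivRel word_eqb word_eqb_refl word_eqb_sym word_eqb_trans.

Definition presented := {eq_quot word_eqb}.
HB.instance Definition _ : EqQuotient _ word_eqb presented :=
  EqQuotient.on presented.
HB.instance Definition _ := Choice.on presented.

Definition word_class (w : seq (X * bool)) : presented := \pi_(presented) w.

Lemma word_classP u v : word_class u = word_class v <-> word_eq u v.
Proof. by split=> [/eqmodP/asboolP|uv]; last exact/eqmodP/asboolP. Qed.

Lemma word_classK g : word_class (repr g) = g. Proof. exact: reprK. Qed.

Definition presented_mul (g h : presented) := word_class (repr g ++ repr h).
Definition presented_inv (g : presented) := word_class (word_inv (repr g)).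

Lemma presented_mulE u v :
  presented_mul (word_class u) (word_class v) = word_class (u ++ v).
Proof. by apply/word_classP; apply: word_eq_cat; apply/word_classP; rewrite word_classK. Qed.

Lemma word_eq_invr u : word_eq (u ++ word_inv u) [::].
Proof.
elim: u => [|[x b] u IH]; first exact: word_eq_refl.
have -> : ((x, b) :: u) ++ word_inv ((x, b) :: u) =
          [:: (x, b)] ++ ((u ++ word_inv u) ++ [:: (x, ~~ b)]).
  by rewrite /word_inv /= rev_cons -cats1 catA.
apply: word_eq_trans (word_eq_cancel x b).
apply: (word_eq_cat (word_eq_refl [:: (x, b)])).
exact: (word_eq_cat IH (word_eq_refl [:: (x, ~~ b)])).
Qed.

Lemma word_invK : involutive word_inv.
Proof.
move=> u; rewrite /word_inv map_rev revK -map_comp.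
by rewrite -[RHS]map_id; apply: eq_map => -[x b] /=; rewrite negbK.
Qed.

Lemma presented_mulA : associative presented_mul.
Proof.
move=> g h k; rewrite -(word_classK g) -(word_classK h) -(word_classK k).
by rewrite !presented_mulE catA.
Qed.

Lemma presented_mul1 : left_id (word_class [::]) presented_mul.
Proof. by move=> g; rewrite -(word_classK g) presented_mulE. Qed.

Lemma presented_1mul : right_id (word_class [::]) presented_mul.
Proof. by move=> g; rewrite -(word_classK g) presented_mulE cats0. Qed.

Lemma presented_mulV :
  left_inverse (word_class [::]) presented_inv presented_mul.
Proof.
move=> g; rewrite /presented_inv -{2}(word_classK g) presented_mulE.
by apply/word_classP; rewrite -{2}(word_invK (repr g)); exact: word_eq_invr.
Qed.

Lemma presented_Vmul :
  right_inverse (word_class [::]) presented_inv presented_mul.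
Proof.
move=> g; rewrite /presented_inv -{1}(word_classK g) presented_mulE.
by apply/word_classP; exact: word_eq_invr.
Qed.

HB.instance Definition _ := isGroup.Build presented presented_mulA
  presented_mul1 presented_1mul presented_mulV presented_Vmul.

End Presentation.

Definition isomorphic (G H : groupType) : Prop :=
  exists phi : {multiplicative G -> H}, bijective phi.

(* (b, a^vee) *)
Definition pairing (T : Type) (f : T -> T -> rat) (b a : T) : rat :=
  if f a a != 0 then 2 * f b a / f a a else 0.

Section AffineReflectionSystems.
Variables (A : zmodType) (f : A -> A -> rat).

Definition psd_form : Prop :=
  [/\ forall b, zmod_morphism (f^~ b),
      forall a, zmod_morphism (f a),
      forall a b, f a b = f b a,
      forall a, 0 <= f a a
    & exists a b, f a b != 0].

Definition radical : set A := [set a | forall b, f a b = 0].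
Definition isotropic (B : set A) : set A := B `&` radical.
Definition nonisotropic (B : set A) : set A := B `\` radical.

Definition gen_subgroup (B : set A) : set A :=
  smallest [set H : set A | H 0 /\ forall a b, H a -> H b -> H (a - b)] B.

Definition affine_reflection_system (R : set A) : Prop :=
  [/\ [set - a | a in R] = R,
      gen_subgroup R = setT
    & forall a b, nonisotropic R a -> R b -> exists d u : nat,
        [set b + a *~ n | n in [set: int]] `&` R =
        [set b + a *~ n | n in [set n : int | - (d%:Z) <= n <= u%:Z]] /\
        d%:R - u%:R = pairing f b a].

Definition irreducible (R : set A) : Prop :=
  ~ exists X Y : set A,
      [/\ X `|` Y = nonisotropic R, X `&` Y = set0, X !=set0, Y !=set0
        & forall x y, X x -> Y y -> f x y = 0].

Definition tame (R : set A) : Prop :=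
  isotropic R `<=`
  [set a - b | a in nonisotropic R & b in nonisotropic R].

(* The image of R in A / A^0 is {0, e, -e} with e nonzero. *)
Definition type_A1 (R : set A) : Prop :=
  exists2 e, ~ radical e & forall a,
    (exists2 r, R r & radical (r - a)) <->
    [\/ radical a, radical (a - e) | radical (a + e)].

(* The description R = (S + S) ∪ (Rdot + S), Rdot = {0, e, -e}, together with
   the normalization (e, e) = 2. *)
Definition A1_data (R : set A) (eps : A) (S : set A) : Prop :=
  [/\ R = [set s + t | s in S & t in S] `|`
          [set a + s | a in [set 0; eps; - eps] & s in S],
      [/\ S `<=` isotropic R, S 0,
          forall s t, S s -> S t -> S (s + t *+ 2) /\ S (s - t *+ 2)
        & gen_subgroup S = radical],
      forall a, exists (n : int) b, radical b /\ a = eps *~ n + b,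
      forall n : int, radical (eps *~ n) -> n = 0
    & f eps eps = 2].

(* w_a on A; (b, a^vee) is an integer when a lies in an affine reflection
   system, and numq reads it off. *)
Definition refl_lattice (a b : A) : A := b - a *~ numq (pairing f b a).

(* W_P; zmodule A is A viewed as a Z-module. *)
Definition weyl (P : set A) : set (aut (zmodule A)) :=
  gen_sub [set g : aut (zmodule A) | exists2 a, P a & g =1 refl_lattice a].

Definition reflectable (R P : set A) : Prop :=
  P `<=` nonisotropic R /\
  [set g a | g in weyl P & a in P] = nonisotropic R.

End AffineReflectionSystems.

Section HyperbolicWeylGroup.
Variables (A : zmodType) (f : A -> A -> rat) (eps : A).
Variables (J : choiceType) (sigma : J -> A).

Local Notation V := (rationalization A).

(* V^0 = Q ⊗ A^0, as the Q-span of A^0 in V. *)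
Definition V0_set : set V := lin_span [set inq a | a in radical f].
Definition V0 := span_type [set inq a | a in radical f].

(* The V^0-component of v in V = Q eps ⊕ V^0. *)
Definition V0_part (v : V) : V0 :=
  xget 0 [set x : V0 | exists q : rat, v = q *: inq eps + \val x].

Definition lambda (j : J) : V0 -> rat^o :=
  xget 0 [set l : V0 -> rat^o | linear l /\
    forall (i : J) (x : V0), \val x = inq (sigma i) -> l x = (i == j)%:R].

Definition V0dag := span_type (range lambda).

Definition Vtilde := (V * V0dag)%type.

Definition form_tilde (x y : Vtilde) : rat :=
  formq f x.1 y.1 + (\val y.2) (V0_part x.1) + (\val x.2) (V0_part y.1).

Definition refl_tilde (a x : Vtilde) : Vtilde :=
  x - pairing form_tilde x a *: a.

Definition hyperbolic_weyl_group (R : set A) : groupType :=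
  gen_group [set g : aut Vtilde |
              exists2 a, R a & g =1 refl_tilde (inq a, 0)].

(* a = sgn(a) eps + p(a) in A = Z eps ⊕ A^0, and the coordinates of p(a) in
   the basis sigma of V^0. *)
Definition sgn_part (a : A) : int :=
  xget 0 [set n : int | radical f (a - eps *~ n)].

Definition ppart (a : A) : A := a - eps *~ sgn_part a.

Definition pcoord (j : J) (a : A) : rat :=
  xget (fun=> 0) [set c : J -> rat | finite_set [set i | c i != 0] /\
    inq (ppart a) = \sum_(i \in [set: J]) c i *: inq (sigma i)] j.

(* Hyper-alternating tuples; entries are numbered from 0 here, hence the
   exponents i.+1, and s starts at 1. *)
Definition hyper_alternating (P : set A) : set (seq A) :=
  [set t : seq A |
    [/\ forall a, a \in t -> P a,
        ~~ odd (size t)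
      & forall j : J,
        \sum_(0 <= i < size t)
           (-1) ^+ i.+1 * (sgn_part t`_i)%:~R * pcoord j t`_i = 0 /\
        \sum_(0 <= s < size t) pcoord j t`_s *: inq (ppart t`_s)
        + 2 *: \sum_(1 <= s < size t)
                 ((-1) ^+ s.+1 * pcoord j t`_s * (sgn_part t`_s)%:~R) *:
                 \sum_(0 <= r < s)
                    ((-1) ^+ r.+1 * (sgn_part t`_r)%:~R) *: inq (ppart t`_r)
        = 0]].

Definition hyper_alternating_presentation (P : set A) : groupType :=
  presented [set w : seq (P * bool) | exists2 t : seq P,
    hyper_alternating P [seq \val a | a <- t] & w = [seq (a, false) | a <- t]].

End HyperbolicWeylGroup.

(* Main.v *)
(** For alpha = s eps + p with s = 1 or -1, the reflection w_alpha of Vtilde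
    sends eps to -eps - 2 s p, fixes V^0 and sends lambda to
    lambda - lambda(p) alpha. By induction on the number of factors the product
    w_{alpha_1} ... w_{alpha_k} has the closed form of [reflection_prodE]; comparing
    components, it is the identity exactly when k is even and
    (alpha_1, ..., alpha_k) is hyper-alternating. In the presented group the
    pairs (alpha, alpha) are relations, so every word is equal to a positive
    one, and a word is trivial there if and only if it acts trivially. Finally
    the w_alpha with alpha in Pi generate: if beta = g(alpha) with g in W_Pi,
    then w_beta is the conjugate of w_alpha by a lift of g to Vtilde. *)
From HB Require Import structures.
Require Import Defs.
From mathcomp Require Import all_boot all_order all_algebra.
From mathcomp Require Import ring.
From mathcomp Require Import boolp classical_sets functions cardinality fsbigop.

Set Implicit Arguments.
Unset Strict Implicit.
Unset Printing Implicit Defensive.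

Import Order.TTheory GRing.Theory Num.Theory.

Local Open Scope classical_set_scope.
Local Open Scope ring_scope.

(** * Evaluation of words in a group, and recognition of a presentation *)

Section WordEvaluation.
Local Open Scope group_scope.
Variables (H : groupType) (X : choiceType) (h : X -> H).

Definition word_eval (w : seq (X * bool)) : H :=
  foldr (fun l g => (if l.2 then (h l.1)^-1 else h l.1) * g) 1 w.

Lemma word_eval_cat u v : word_eval (u ++ v) = word_eval u * word_eval v.
Proof. by elim: u => [|l u IH]; rewrite /= ?mul1g// IH mulgA. Qed.

Lemma word_eval_inv w : word_eval (word_inv w) = (word_eval w)^-1.
Proof.
elim: w => [|[x b] w IH]; first by rewrite /= invg1.
rewrite /word_inv /= rev_cons -cats1 word_eval_cat -/(word_inv w) IH /= mulg1.
by rewrite invgM; congr (_ * _); case: b => //=; rewrite invgK.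
Qed.

Variable rels : set (seq (X * bool)).

Lemma word_eval_eq u v : (forall r, rels r -> word_eval r = 1) ->
  word_eq rels u v -> word_eval u = word_eval v.
Proof.
move=> relsP; elim=> {u v} //.
- by move=> u v w _ -> _ ->.
- by move=> u u' v v' _ e _ e'; rewrite !word_eval_cat e e'.
- by move=> x [] /=; rewrite mulg1 ?mulVg ?mulgV.
Qed.

(** The relation x x = 1 makes x its own inverse: the letter x^-1 becomes x^-1 x x and then x. *)
Lemma word_eq_positive w : (forall x, rels [:: (x, false); (x, false)]) ->
  word_eq rels w [seq (l.1, false) | l <- w].
Proof.
move=> relsP; elim: w => [|[x b] w IH]; first exact: word_eq_refl.
rewrite /= -[(x, b) :: _]cat1s -[(x, false) :: _]cat1s; apply: word_eq_cat => //.
case: b; last exact: word_eq_refl.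
apply: (@word_eq_trans _ _ _ [:: (x, true); (x, false); (x, false)]).
  have := word_eq_cat (word_eq_refl rels [:: (x, true)])
    (word_eq_sym (word_eq_rel (relsP x))).
  by rewrite cats0.
exact: (word_eq_cat (word_eq_cancel rels x true) (word_eq_refl _ [:: (x, false)])).
Qed.

(** The first two hypotheses say that the values of words are exactly the subgroup generated by [B];
    the third says that the kernel of evaluation consists of the words trivial in the
    presentation. *)
Lemma isomorphic_presented (B : set H) :
  (forall x, gen_sub B (h x)) ->
  (forall g, B g -> exists w, word_eval w = g) ->
  (forall w, word_eval w = 1 <-> word_eq rels w [::]) ->
  isomorphic (gen_group B) (presented rels).
Proof.
move=> hB Bh kerP.
have genP (g : H) : gen_sub B g -> exists w, word_eval w = g.
  move/(_ [set k | exists w, word_eval w = k]); apply; split => //=.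
  split=> [|x y [u <-] [v <-]]; first by exists [::].
  by exists (u ++ word_inv v); rewrite word_eval_cat word_eval_inv.
have evalB w : gen_sub B (word_eval w).
  elim: w => [|[x b] w IH]; first by move=> U [[]].
  move=> U UB; have [[U1 UD] _] := UB.
  (* Generated subgroups are defined by closure under division, so a product is written as a /
     c^-1. *)
  have UM a c : U a -> U c -> U (a * c).
    move=> Ua Uc; rewrite -[c]invgK; apply: (UD) => //.
    by rewrite -[c^-1]mul1g; exact: UD.
  apply: UM; last exact: IH.
  have Uh : U (h x) by exact: hB.
  by case: b => //=; rewrite -[_^-1]mul1g; exact: UD.
have evalP u v : word_eval u = word_eval v <-> word_eq rels u v.
  split=> [e|]; last by apply: word_eval_eq => r /word_eq_rel/kerP.
  have /kerP e1 : word_eval (u ++ word_inv v) = 1.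
    by rewrite word_eval_cat word_eval_inv e mulgV.
  (* Insert v^-1 v after u, then delete u v^-1, which lies in the kernel. *)
  apply: (@word_eq_trans _ _ _ (u ++ (word_inv v ++ v))).
    have /word_eq_sym/(word_eq_cat (word_eq_refl rels u)) := word_eq_invr rels (word_inv v).
    by rewrite cats0 word_invK.
  by rewrite catA; exact: (word_eq_cat e1 (word_eq_refl _ v)).
(* Any word with value g will do: by [evalP] its class depends on g only, which also makes [phi]
   multiplicative. *)
pose word_of (g : gen_group B) := xget [::] [set w | word_eval w = val g].
have word_ofK g : word_eval (word_of g) = val g.
  by apply: (@xgetPex _ [::] [set w | word_eval w = val g]); apply: genP; apply/asboolP/(valP g).
pose phi g : presented rels := word_class rels (word_of g).
have phiM : {morph phi : x y / x * y}.
  move=> x y; rewrite /phi; apply/esym.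
  rewrite -[LHS]/(presented_mul _ _) presented_mulE.
  by apply/word_classP/evalP; rewrite word_eval_cat !word_ofK.
pose phi_mul := isMultiplicative.Build (gen_group B) (presented rels) phi phiM.
pose Phi : {multiplicative gen_group B -> presented rels} := HB.pack phi phi_mul.
exists Phi; rewrite /Phi /=.
pose psi (g : presented rels) : gen_group B :=
  exist _ (word_eval (repr g)) (asboolT (evalB (repr g))).
exists psi => g.
  apply: val_inj; rewrite /= -word_ofK; apply/evalP/word_classP.
  by rewrite word_classK.
rewrite -[RHS](word_classK g); apply/word_classP/evalP.
by rewrite word_ofK.
Qed.

End WordEvaluation.

(** * Finitely supported coordinates in a basis *)

Section Coordinates.
Variables (K : nzRingType) (V : lmodType K) (J : choiceType) (e : J -> V).
Implicit Types (c d : J -> K) (v : V).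

Definition coords c v : Prop :=
  finite_set [set i | c i != 0] /\ v = \sum_(i \in [set: J]) c i *: e i.

Lemma coords_finite c (s : seq J) : uniq s -> (forall i, i \notin s -> c i = 0) ->
  \sum_(i \in [set: J]) c i *: e i = \sum_(i <- s) c i *: e i.
Proof.
move=> us cs; rewrite [RHS]fsbig_seq//; apply/esym/fsbig_widen => // i /= [_ /negP].
by move=> /cs ->; rewrite scale0r.
Qed.

Lemma coordsP c v : coords c v <-> exists s : seq J,
  [/\ uniq s, forall i, i \notin s -> c i = 0 & v = \sum_(i <- s) c i *: e i].
Proof.
split=> [[/finite_seqP[s sE] ->]|[s [us cs ->]]]; last first.
  split; last by rewrite (coords_finite us).
  apply: (sub_finite_set (B := [set` s])); last exact: finite_seq.
  by move=> i /= ci; apply: contra_neqT ci => /cs.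
have cs i : i \notin undup s -> c i = 0.
  rewrite mem_undup => si; apply: contraNeq si => ci.
  by have : [set i | c i != 0] i by []; rewrite sE.
by exists (undup s); split; rewrite ?undup_uniq// (coords_finite (undup_uniq _) cs).
Qed.

(** The expansion holds over every duplicate-free list containing a suitable [s], so two vectors can
    be expanded over a common list. *)
Lemma coords_widen c v : coords c v -> exists s : seq J, forall r : seq J,
  uniq r -> {subset s <= r} ->
  (forall i, i \notin r -> c i = 0) /\ v = \sum_(i <- r) c i *: e i.
Proof.
move=> /[dup] -[_ vE] /coordsP[s [us cs _]]; exists s => r ur sr.
have cr i : i \notin r -> c i = 0 by move=> ir; apply: cs; apply: contra ir; apply: sr.
by split=> //; rewrite vE (coords_finite ur).
Qed.

Lemma coords_linear k c d u v :
  coords c u -> coords d v -> coords (fun i => k * c i + d i) (k *: u + v).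
Proof.
move=> /coords_widen[s sP] /coords_widen[r rP]; apply/coordsP.
exists (undup (s ++ r)).
have [||c0 ->] := sP (undup (s ++ r)); rewrite ?undup_uniq//.
  by move=> i si; rewrite mem_undup mem_cat si.
have [||d0 ->] := rP (undup (s ++ r)); rewrite ?undup_uniq//.
  by move=> i si; rewrite mem_undup mem_cat si orbT.
split=> // [i ir|]; first by rewrite c0// d0// mulr0 addr0.
rewrite scaler_sumr -big_split; apply: eq_bigr => i _ /=.
by rewrite scalerDl scalerA.
Qed.

Lemma coords_basis j : coords (fun i => (j == i)%:R) (e j).
Proof.
apply/coordsP; exists [:: j]; split => // [i|]; last by rewrite big_seq1 eqxx scale1r.
by rewrite inE eq_sym => /negPf ->.
Qed.

Lemma coords0 : coords (fun=> 0) 0.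
Proof. by apply/coordsP; exists [::]; split => //; rewrite big_nil. Qed.

Variable U : set V.
Hypothesis eU : is_basis e U.

Lemma coords_exist v : U v -> exists c, coords c v.
Proof.
have [_ <-] := eU; move/(_ [set w | exists c, coords c w]); apply; split => /=; last first.
  by move=> _ [j _ <-]; exists (fun i => (j == i)%:R); exact: coords_basis.
split; first by exists (fun=> 0); exact: coords0.
move=> k u w [c cu] [d dw]; exists (fun i => k * c i + d i); exact: coords_linear.
Qed.

Lemma coords_uniq c d v : coords c v -> coords d v -> c = d.
Proof.
move=> cv dv; have := coords_linear (-1) cv dv.
rewrite scaleN1r addNr => /coordsP[s [us cs /esym s0]]; apply/funext => i.
have [is_|/cs] := boolP (i \in s).
  have := eU.1 s _ us s0 i is_.
  by rewrite mulN1r addrC => /eqP; rewrite subr_eq0 => /eqP.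
by rewrite mulN1r addrC => /eqP; rewrite subr_eq0 => /eqP.
Qed.

Definition basis_coord v : J -> K := xget (fun=> 0) [set c | coords c v].

Lemma basis_coordP v : U v -> coords (basis_coord v) v.
Proof. by move=> /coords_exist; exact: (@xgetPex _ (fun=> 0) [set c | coords c v]). Qed.

Lemma basis_coordE c v : coords c v -> basis_coord v = c.
Proof. by move=> cv; apply: xget_unique => // d dv; exact: coords_uniq dv cv. Qed.

End Coordinates.

Lemma lin_span_sub (K : pzRingType) (V : lmodType K) (B : set V) v :
  B v -> lin_span B v.
Proof. by move=> Bv U [_]; apply. Qed.

Lemma span_typeP (K : pzRingType) (V : lmodType K) (B : set V) (v : span_type B) :
  lin_span B (val v).
Proof. exact/asboolP/(valP v). Qed.

Definition to_span (K : pzRingType) (V : lmodType K) (B : set V) (v : V)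
  (Bv : lin_span B v) : span_type B := exist _ v (asboolT Bv).

(** * The form on A and its extension to the rationalization *)

Section RationalForm.
Variables (A : zmodType) (f : A -> A -> rat).
Hypothesis f_form : psd_form f.

Let fl b : zmod_morphism (f^~ b). Proof. by case: f_form. Qed.
Let fr a : zmod_morphism (f a). Proof. by case: f_form. Qed.

Definition form_left_add b : {additive A -> rat} :=
  HB.pack (f^~ b) (GRing.isZmodMorphism.Build _ _ _ (fl b)).

Definition form_right_add a : {additive A -> rat} :=
  HB.pack (f a) (GRing.isZmodMorphism.Build _ _ _ (fr a)).

Lemma form_sym a b : f a b = f b a. Proof. by case: f_form. Qed.

Lemma psd_formDl a b c : f (a + b) c = f a c + f b c.
Proof. exact: (raddfD (form_left_add c)). Qed.

Lemma psd_formDr a b c : f a (b + c) = f a b + f a c.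
Proof. exact: (raddfD (form_right_add a)). Qed.

Lemma psd_formBr a b c : f a (b - c) = f a b - f a c.
Proof. exact: (raddfB (form_right_add a)). Qed.

Lemma psd_formMz a b n : f (a *~ n) b = f a b * n%:~R.
Proof. by rewrite -[LHS]/(form_left_add b _) raddfMz mulrzr. Qed.

Lemma psd_formMzr a b n : f a (b *~ n) = f a b * n%:~R.
Proof. by rewrite form_sym psd_formMz form_sym. Qed.

Lemma radicalB a b : radical f a -> radical f b -> radical f (a - b).
Proof.
move=> fa fb c; rewrite form_sym psd_formBr !(form_sym c).
by rewrite fa fb subrr.
Qed.

Lemma radicalD a b : radical f a -> radical f b -> radical f (a + b).
Proof. by move=> fa fb c; rewrite psd_formDl fa fb addr0. Qed.

Lemma formq_inqE b n a : (0 < n)%N ->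
  formq f (qfrac b n) (inq a) = f b a / n%:R.
Proof. by case: n => // n _; rewrite formqE// mulr1. Qed.

Lemma formq_inq a b : formq f (inq a) (inq b) = f a b.
Proof. by rewrite formqE// !mulr1n mulr1 divr1. Qed.

Lemma formq_linear a k u v :
  formq f (k *: u + v) (inq a) = k * formq f u (inq a) + formq f v (inq a).
Proof.
have formqD x y : formq f (x + y) (inq a) = formq f x (inq a) + formq f y (inq a).
  have [b [n ->]] := qfracW x; have [c [m ->]] := qfracW y.
  rewrite -[_ + _ in LHS]/(qfrac_add _ _) qfrac_addE// !formq_inqE ?muln_gt0//.
  by rewrite psd_formDl !pmulrn !psd_formMz -!pmulrn natrM; field; rewrite !nat1r !pnatr_eq0.
have formqZ x : formq f (k *: x) (inq a) = k * formq f x (inq a).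
  have [b [n ->]] := qfracW x; rewrite -[_ *: _]/(qfrac_scale _ _).
  have d0 : (0 < `|denq k|)%N by rewrite absz_gt0 denq_neq0.
  have dE : `|denq k|%:R = (denq k)%:~R :> rat by rewrite pmulrn absz_denq.
  rewrite (@qfrac_scaleE _ k (numq k) `|denq k|)//; last by rewrite dE divq_num_den.
  rewrite !formq_inqE ?muln_gt0// psd_formMz natrM dE numqE.
  by field; rewrite intr_eq0 denq_neq0 nat1r pnatr_eq0.
by rewrite formqD formqZ.
Qed.

Lemma formq_inqB v a b : formq f v (inq (a - b)) = formq f v (inq a) - formq f v (inq b).
Proof.
by have [c [n ->]] := qfracW v; rewrite !formq_inqE// psd_formBr mulrBl.
Qed.

(** The vectors orthogonal to [inq a] form a subspace, and it contains the generators of V^0. *)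
Lemma formq_radical a v : V0_set f v -> formq f v (inq a) = 0.
Proof.
move=> v0; apply: (v0 [set v | formq f v (inq a) = 0]); split => /=.
  split=> [|k u w u0 w0]; last by rewrite formq_linear u0 w0 mulr0 addr0.
  by have := formq_linear a (-1) 0 0; rewrite scaler0 addr0 mulN1r addNr.
by move=> _ [b b0 <-] /=; rewrite formq_inq b0.
Qed.

End RationalForm.
(** The induction step of [reflection_prodE] in abstract form: e stands for (-1)^n, s and p for the
    sign and the radical part of the new root, c for lambda(p), F for [eps_image] and D for
    [dag_image]. *)
Lemma reflection_step (K : comNzRingType) (V : lmodType K) (q e s c : K) (F p v D : V) :
  e * e = 1 -> s * s = 1 ->
  ((q - (2 * q * s + c) * s) * e) *: F + (v - (2 * q * s + c) *: p) - D =
  (q * (- 1 * e)) *: (F + (2 * e * s) *: p) + v - (D + c *: (p + (e * s) *: F)).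
Proof.
move=> e1 s1.
have -> : (q - (2 * q * s + c) * s) * e = - (q * e) - c * (e * s).
  by transitivity (q * e - 2 * q * e * (s * s) - c * (e * s)); [ring|rewrite s1; ring].
have E1 : q * (- 1 * e) = - (q * e) by ring.
have E2 : - (q * e) * (2 * e * s) = - (2 * q * s).
  by transitivity (- (2 * q * s) * (e * e)); [ring|rewrite e1 mulr1].
rewrite E1 !scalerDr !scalerA E2 !scalerDl !scaleNr !opprD !addrA.
by rewrite [LHS](ACl (1*4*3*6*5*2)).
Qed.

(** * The splitting along eps, and the functionals lambda *)

Section Hyperbolic.
Variables (A : zmodType) (f : A -> A -> rat) (eps : A).
Variables (J : choiceType) (sigma : J -> A).
Hypothesis f_form : psd_form f.
Hypothesis eps_split : forall a, exists (n : int) b, radical f b /\ a = eps *~ n + b.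
Hypothesis eps_free : forall n : int, radical f (eps *~ n) -> n = 0.
Hypothesis eps_norm : f eps eps = 2.
Hypothesis sigma_basis : is_basis (fun j : J => inq (sigma j)) (V0_set f).

Notation sgn := (sgn_part f eps).
Notation pr := (ppart f eps).
Notation E := (inq eps).
Notation lam := (@lambda A f J sigma).

(** For two candidates m and n the difference of the two radical elements is eps (m - n), so
    [eps_free] forces m = n. *)
Lemma sgn_partE a n : radical f (a - eps *~ n) -> sgn a = n.
Proof.
move=> an; apply: xget_unique => // m am; apply/eqP; rewrite -subr_eq0; apply/eqP.
apply: eps_free; rewrite mulrzBr.
have -> : eps *~ m - eps *~ n = (a - eps *~ n) - (a - eps *~ m).
  by rewrite opprB [RHS]addrC addrA subrK.
exact: radicalB.
Qed.

Lemma ppart_radical a : radical f (pr a).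
Proof.
have [n [b [b0 ->]]] := eps_split a.
rewrite /ppart (@sgn_partE (eps *~ n + b) n) addrC addKr //.
Qed.

Lemma sgn_part_zmod : zmod_morphism sgn.
Proof.
move=> a b; apply: sgn_partE; rewrite mulrzBr opprD addrACA -opprD.
move: (ppart_radical a) (ppart_radical b); exact: radicalB.
Qed.

Lemma ppart_zmod : zmod_morphism pr.
Proof. by move=> a b; rewrite /ppart sgn_part_zmod mulrzBr opprD addrACA -opprD. Qed.

Lemma inq_split a : inq a = (sgn a)%:~R *: E + inq (pr a).
Proof. by rewrite scaler_int -raddfMz -raddfD /ppart addrC subrK. Qed.

Lemma V0_ppart a : V0_set f (inq (pr a)).
Proof. by rewrite /V0_set; apply: lin_span_sub; exists (pr a) => //; exact: ppart_radical. Qed.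

Lemma V0_val (x : V0 f) : V0_set f (val x).
Proof. exact (span_typeP x). Qed.

Lemma formq_split q (x : V0 f) a :
  formq f (q *: E + val x) (inq a) = 2 * q * (sgn a)%:~R.
Proof.
rewrite formq_linear// (formq_radical f_form a (V0_val x)) addr0.
rewrite formq_inq// [in f eps a](_ : a = eps *~ sgn a + pr a); last by rewrite addrC subrK.
rewrite psd_formDr// psd_formMzr// eps_norm (form_sym f_form eps) ppart_radical addr0.
by rewrite mulrA [q * 2]mulrC.
Qed.

Lemma sgn_eps : sgn eps = 1.
Proof.
apply: sgn_partE; rewrite mulr1z subrr => b.
by rewrite -[LHS]/(form_left_add f_form b 0) raddf0.
Qed.

(** Pairing with eps kills V^0 and returns twice the coefficient of eps. *)
Lemma eps_coeff_inj q r (x y : V0 f) : q *: E + val x = r *: E + val y -> q = r /\ x = y.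
Proof.
move=> e; have qr : q = r.
  have := congr1 (fun v => formq f v E) e; rewrite !formq_split sgn_eps !mulr1.
  by apply: mulfI.
by split=> //; apply: val_inj; move: e; rewrite qr => /addrI.
Qed.

Lemma V0_partE q (x : V0 f) : V0_part f eps (q *: E + val x) = x.
Proof. by apply: xget_unique => [|y [r /eps_coeff_inj[]//]]; exists q. Qed.

(** This is p(a) as an element of V^0, in the form in which [form_tilde] produces it. *)
Definition V0_proj a : V0 f := V0_part f eps (inq a).

Lemma val_V0_proj a : val (V0_proj a) = inq (pr a).
Proof. by rewrite /V0_proj inq_split -[inq (pr a)]/(val (to_span (V0_ppart a))) V0_partE. Qed.

Lemma V0_proj_zmod : zmod_morphism V0_proj.
Proof. by move=> a b; apply: val_inj; rewrite raddfB /= !val_V0_proj ppart_zmod raddfB. Qed.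

Lemma eps_decomp v : exists q (x : V0 f), v = q *: E + val x.
Proof.
have [a [n ->]] := qfracW v; rewrite qfracE inq_split scalerDr scalerA.
exists (n.+1%:R^-1 * (sgn a)%:~R), (n.+1%:R^-1 *: V0_proj a).
by rewrite linearZ /= val_V0_proj.
Qed.

(** [lambda] is chosen by [xget], so a witness is required: the j-th coordinate in the basis
    sigma. *)
Lemma lambda_spec j : linear (lam j) /\
  forall (i : J) (x : V0 f), val x = inq (sigma i) -> lam j x = (i == j)%:R.
Proof.
apply: (@xgetPex _ 0 [set l : V0 f -> rat^o | linear l /\
    forall (i : J) (x : V0 f), val x = inq (sigma i) -> l x = (i == j)%:R]).
exists (fun x => basis_coord (fun j => inq (sigma j)) (val x) j); split=> [k x y|i x ->].
  have := coords_linear k (basis_coordP sigma_basis (span_typeP x))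
    (basis_coordP sigma_basis (span_typeP y)).
  by rewrite linearP => /(basis_coordE sigma_basis) ->.
by rewrite (basis_coordE sigma_basis (coords_basis _ i)).
Qed.

Lemma V0_sigma j : V0_set f (inq (sigma j)).
Proof. by have [_ <-] := sigma_basis; apply: lin_span_sub; exists j. Qed.

Lemma lambda_coords c (x : V0 f) j :
  coords (fun j => inq (sigma j)) c (val x) -> lam j x = c j.
Proof.
(* Adding j to the list lets the j-th term be isolated even when j is outside the support of c. *)
move=> /[dup] xc /coords_widen[s /(_ (undup (j :: s)) (undup_uniq _))[]].
  by move=> i si; rewrite mem_undup inE si orbT.
move=> _ xE; have [lin lb] := lambda_spec j.
pose l : {linear V0 f -> rat^o} := HB.pack (lam j)
  (GRing.isLinear.Build _ _ _ _ _ lin).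
have -> : x = \sum_(i <- undup (j :: s)) c i *: to_span (V0_sigma i).
  apply: val_inj; rewrite xE raddf_sum; exact: eq_bigr.
have lE i : l (c i *: to_span (V0_sigma i)) = c i * (i == j)%:R.
  by rewrite -(lb i (to_span (V0_sigma i)) erefl); exact: (linearZ_LR l).
rewrite -[LHS]/(l _) linear_sum (eq_bigr _ (fun i _ => lE i)).
rewrite (bigD1_seq j) ?undup_uniq ?mem_undup ?mem_head//= eqxx mulr1.
by rewrite big1 ?addr0// => i /negPf ->; rewrite mulr0.
Qed.

Lemma lambda_sep (x : V0 f) : (forall j, lam j x = 0) -> x = 0.
Proof.
move=> x0; have [c xc] := coords_exist sigma_basis (span_typeP x).
apply: val_inj; have [_ ->] := xc; rewrite raddf0; apply: fsbig1 => i _.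
by rewrite -(lambda_coords i xc) x0 scale0r.
Qed.

Lemma pcoordE j a : pcoord f eps sigma j a = lam j (V0_proj a).
Proof.
have [c ac] := coords_exist sigma_basis (V0_ppart a).
rewrite (@lambda_coords c) ?val_V0_proj//; congr (_ j).
by apply: xget_unique => // d /(coords_uniq sigma_basis ac).
Qed.

(** * Reflections of the hyperbolic space *)

Notation dag := (V0dag f sigma).

Lemma lambda_dag j : lin_span (range (lam)) (lam j).
Proof. by apply: lin_span_sub; exists j. Qed.

(** [V0dag] is a span of plain functions; linearity passes from each lambda to the span because
    linear maps form a subspace. *)
Lemma dag_linear (l : dag) : linear (val l).
Proof.
have := span_typeP l; move/(_ [set m | linear m]); apply; split => /=.
  split=> [k x y|k m n ml nl h x y]; first by rewrite scaler0 addr0.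
  rewrite !fctE ml nl !scalerDr !scalerA mulrC; rewrite addrACA; congr (_ + _).
by move=> _ [j _ <-] /=; have [] := lambda_spec j.
Qed.

(** The value of [form_tilde] at x and (a, 0), where the term with the zero functional drops out. *)
Definition copairing a (x : Vtilde f sigma) : rat := formq f x.1 (inq a) + val x.2 (V0_proj a).

Lemma copairing_linear a k x y :
  copairing a (k *: x + y) = k * copairing a x + copairing a y.
Proof.
case: x y => [u l] [v m].
change (formq f (k *: u + v) (inq a) + (k * val l (V0_proj a) + val m (V0_proj a)) =
  k * (formq f u (inq a) + val l (V0_proj a)) + (formq f v (inq a) + val m (V0_proj a))).
by rewrite (formq_linear f_form) mulrDr addrACA.
Qed.

Lemma copairing_zmod x : zmod_morphism (copairing^~ x).
Proof.
move=> a b; rewrite /copairing (formq_inqB f_form) opprD addrACA; congr (_ + _).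
pose l : {linear V0 f -> rat^o} := HB.pack (val x.2)
  (GRing.isLinear.Build _ _ _ _ _ (dag_linear x.2)).
by rewrite V0_proj_zmod -[LHS]/(l _) raddfB.
Qed.

Lemma copairing_inq a b : copairing a (inq b, 0) = f b a.
Proof. by rewrite /copairing (formq_inq f_form) /= addr0. Qed.

(** When (a, a) = 2 the coroot pairing is the form itself, so this division-free formula gives
    w_a. *)
Definition reflection a x : Vtilde f sigma := x - copairing a x *: (inq a, 0).

Lemma refl_tildeE a x : f a a = 2 -> refl_tilde eps (inq a, 0) x = reflection a x.
Proof.
move=> a2; rewrite /refl_tilde /pairing /form_tilde /= (formq_inq f_form) a2 !addr0.
by rewrite -/(V0_proj a) mulrAC divff// mul1r.
Qed.

Lemma refl_tilde_radical a (x : Vtilde f sigma) : f a a = 0 -> refl_tilde eps (inq a, 0) x = x.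
Proof.
move=> a0; rewrite /refl_tilde /pairing /form_tilde /= (formq_inq f_form) a0 !addr0.
by rewrite eqxx scale0r subr0.
Qed.

Lemma reflection_linear a : linear (reflection a).
Proof.
move=> k x y; rewrite /reflection copairing_linear scalerDl -scalerA opprD addrACA.
by rewrite -scalerBr.
Qed.

Lemma reflectionK a : f a a = 2 -> involutive (reflection a).
Proof.
move=> a2 x; rewrite {1}/reflection.
have -> : copairing a (reflection a x) = - copairing a x.
  rewrite /reflection addrC -scaleNr copairing_linear copairing_inq a2.
  by ring.
by rewrite /reflection scaleNr opprK subrK.
Qed.

Lemma reflection_is_aut a : f a a = 2 -> is_aut (reflection a).
Proof.
move=> a2; apply/asboolP; split; first exact: reflection_linear.
by exists (reflection a); exact: reflectionK.
Qed.

Definition reflection_aut a (a2 : f a a = 2) : aut (Vtilde f sigma) :=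
  exist _ (reflection a) (reflection_is_aut a2).

(** * Closed form for products of reflections *)

Definition reflection_prod (t : seq A) x := foldr reflection x t.

(** Its coordinates are the left sides of the first hyper-alternating condition; the exponent r.+1
    compensates for numbering from 0. *)
Definition alt_sum (t : seq A) n : V0 f :=
  \sum_(0 <= r < n) ((-1) ^+ r.+1 * (sgn t`_r)%:~R) *: V0_proj t`_r.

(** Up to the factor (-1)^n, the image of eps under the product of the first n reflections. *)
Definition eps_image (t : seq A) n := E - 2 *: val (alt_sum t n).

Lemma eps_imageS t n :
  eps_image t n.+1 = eps_image t n + (2 * (-1) ^+ n * (sgn t`_n)%:~R) *: inq (pr t`_n).
Proof.
rewrite /eps_image /alt_sum big_nat_recr//= scalerDr opprD addrA; congr (_ + _).
rewrite -[sval _]/(val _) val_V0_proj scalerA -scaleNr; congr (_ *: _).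
by rewrite exprS; ring.
Qed.

(** What the product of the first n reflections subtracts from a functional l. *)
Definition dag_image (t : seq A) n (l : V0 f -> rat^o) : rationalization A :=
  \sum_(0 <= m < n) (l (V0_proj t`_m) : rat) *:
     (inq (pr t`_m) + ((-1) ^+ m * (sgn t`_m)%:~R) *: eps_image t m).

Lemma reflection_split a (q : rat) (x : V0 f) (l : dag) : let c : rat := val l (V0_proj a) in
  let k := 2 * q * (sgn a)%:~R + c in
  reflection a (q *: E + val x, l) =
  ((q - k * (sgn a)%:~R) *: E + val (x - k *: V0_proj a), l).
Proof.
move=> c k; rewrite /reflection.
have -> : copairing a (q *: E + val x, l) = k by rewrite /copairing /= formq_split.
change ((q *: E + val x - k *: inq a, l - k *: 0) =
  ((q - k * (sgn a)%:~R) *: E + (val x - k *: val (V0_proj a)), l)).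
rewrite scaler0 subr0 val_V0_proj [in k *: _]inq_split scalerDr scalerA opprD addrACA.
by rewrite scalerBl.
Qed.

(** Induction on n. The last of the n + 1 reflections acts first and changes q and x but not l, so q
    and x are generalized. *)
Lemma reflection_prodE (t : seq A) n (q : rat) (x : V0 f) (l : dag) :
  (forall a, a \in t -> sgn a * sgn a = 1) -> (n <= size t)%N ->
  reflection_prod (take n t) (q *: E + val x, l) =
  ((q * (-1) ^+ n) *: eps_image t n + val x - dag_image t n (val l), l).
Proof.
move=> sgn1; elim: n q x => [|n IH] q x nt.
  rewrite take0 mulr1 /eps_image /alt_sum /dag_image !big_geq//.
  by rewrite -[val 0]/(0 : rationalization A) scaler0 !subr0.
rewrite (take_nth 0)// /reflection_prod -cats1 foldr_cat -/(reflection_prod _ _).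
rewrite [foldr _ _ [:: _]]reflection_split IH ?(ltnW nt)//.
rewrite eps_imageS /dag_image big_nat_recr//= -/(dag_image t n (val l)) exprS.
congr pair; rewrite -val_V0_proj -reflection_step//.
  by rewrite -expr2 sqrr_sign.
by rewrite -intrM sgn1// mem_nth.
Qed.

Lemma dag_image_linear t n k (l m : V0 f -> rat^o) :
  dag_image t n (k *: l + m) = k *: dag_image t n l + dag_image t n m.
Proof.
rewrite /dag_image scaler_sumr -big_split; apply: eq_bigr => i _ /=.
by rewrite scalerA -scalerDl.
Qed.

(** Substituting eps - 2 [alt_sum] for [eps_image] separates the left side of the second condition,
    which lies in V^0, from a multiple of eps given by the first. *)
Lemma dag_image_lambda t n j :
  dag_image t n (lam j) =
  (\sum_(0 <= s < n) pcoord f eps sigma j t`_s *: inq (pr t`_s)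
   + 2 *: \sum_(1 <= s < n)
            ((-1) ^+ s.+1 * pcoord f eps sigma j t`_s * (sgn t`_s)%:~R) *:
            \sum_(0 <= r < s) ((-1) ^+ r.+1 * (sgn t`_r)%:~R) *: inq (pr t`_r))
  - (\sum_(0 <= i < n) (-1) ^+ i.+1 * (sgn t`_i)%:~R * pcoord f eps sigma j t`_i) *: E.
Proof.
have valS s : \sum_(0 <= r < s) ((-1) ^+ r.+1 * (sgn t`_r)%:~R) *: inq (pr t`_r)
    = val (alt_sum t s).
  rewrite /alt_sum raddf_sum; apply: eq_bigr => r _.
  by rewrite -val_V0_proj.
(* The sum may start at 0, since [alt_sum t 0] is empty. *)
have -> : \sum_(1 <= s < n)
      ((-1) ^+ s.+1 * pcoord f eps sigma j t`_s * (sgn t`_s)%:~R) *: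
            \sum_(0 <= r < s) ((-1) ^+ r.+1 * (sgn t`_r)%:~R) *: inq (pr t`_r) =
   \sum_(0 <= s < n)
      ((-1) ^+ s.+1 * pcoord f eps sigma j t`_s * (sgn t`_s)%:~R) *: val (alt_sum t s).
  case: n => [|n]; first by rewrite !big_geq.
  rewrite [RHS]big_ltn// [alt_sum t 0]big_geq//.
  rewrite -[val 0]/(0 : rationalization A) scaler0 add0r.
  by apply: eq_bigr => s _; rewrite valS.
rewrite scaler_sumr scaler_suml -big_split -sumrB /dag_image.
apply: eq_bigr => s _ /=; rewrite -pcoordE scalerDr -addrA; congr (_ + _).
rewrite scalerA /eps_image scalerBr !scalerA addrC -scaleNr -[in RHS]scaleNr.
by congr (_ *: _ + _ *: _); rewrite exprS; ring.
Qed.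

Lemma reflection_prod_eq1 (t : seq A) : (forall a, a \in t -> sgn a * sgn a = 1) ->
  (forall x, reflection_prod t x = x) <->
  [/\ ~~ odd (size t), alt_sum t (size t) = 0 &
    forall j, dag_image t (size t) (lam j) = 0].
Proof.
move=> sgn1; set n := size t.
have prodE q (x : V0 f) (l : dag) : reflection_prod t (q *: E + val x, l) =
    ((q * (-1) ^+ n) *: eps_image t n + val x - dag_image t n (val l), l).
  by have := @reflection_prodE t n q x l sgn1 (leqnn _); rewrite take_size.
have dag0 : dag_image t n (val (0 : dag)) = 0.
  have := dag_image_linear t n (-1) 0 0.
  by rewrite scaler0 addr0 scaleN1r addNr.
split=> [t1|[nodd a0 tP] [v l]].
  (* At eps, comparing the two components gives (-1)^n = 1 and [alt_sum] = 0. *)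
  have := t1 (1 *: E + val (0 : V0 f), 0 : dag); rewrite prodE => /(congr1 fst).
  rewrite /fst dag0 subr0 -[val 0]/(0 : rationalization A) !addr0 mul1r => e.
  have [e1 a0] : (-1) ^+ n = 1 :> rat /\ ((-1) ^+ n.+1 * 2) *: alt_sum t n = 0 :> V0 f.
    apply: eps_coeff_inj; rewrite -[RHS]addr0 -[0 in RHS]/(val (0 : V0 f)) in e *.
    rewrite -e /eps_image scalerBr; congr (_ + _).
    by rewrite scalerA -scaleNr exprS mulN1r mulNr.
  have {}a0 : alt_sum t n = 0.
    by move/eqP: a0; rewrite scaler_eq0 mulf_eq0 signr_eq0 /= => /eqP.
  split=> // [|j].
    by move/eqP: e1; rewrite -signr_odd; case: odd.
  (* At lambda_j only [dag_image] remains. *)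
  have := t1 (0 *: E + val (0 : V0 f), to_span (lambda_dag j)).
  rewrite prodE => /(congr1 fst); rewrite /fst mul0r !scale0r !add0r.
  by move=> /eqP; rewrite oppr_eq0 => /eqP.
have l0 : dag_image t n (val l) = 0.
  have lP := span_typeP l.
  apply: (lP [set m | dag_image t n m = 0]); split=> [|_ [j _ <-]] /=; last exact: tP.
  split=> [|k m m' m0 m'0]; first exact: dag0.
  by rewrite dag_image_linear m0 m'0 scaler0 addr0.
have [q [x ->]] := eps_decomp v; rewrite prodE l0 subr0.
rewrite -signr_odd (negPf nodd) mulr1.
by rewrite /eps_image a0 -[val 0]/(0 : rationalization A) scaler0 subr0.
Qed.

Lemma lambda_alt_sum (t : seq A) n j : lam j (alt_sum t n) =
  \sum_(0 <= i < n) (-1) ^+ i.+1 * (sgn t`_i)%:~R * pcoord f eps sigma j t`_i.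
Proof.
have [lin _] := lambda_spec j.
pose l : {linear V0 f -> rat^o} := HB.pack (lam j)
  (GRing.isLinear.Build _ _ _ _ _ lin).
rewrite -[LHS]/(l _) /alt_sum linear_sum; apply: eq_bigr => i _.
by rewrite pcoordE; exact: (linearZ_LR l).
Qed.

(** Since the lambda_j separate points of V^0, the first condition for all j means [alt_sum] = 0.
    The eps-component in [dag_image_lambda] then vanishes, and the second condition becomes
    [dag_image] = 0 at each lambda_j. *)
Lemma hyper_alternatingP (P : set A) (t : seq A) :
  (forall a, P a -> sgn a * sgn a = 1) ->
  hyper_alternating f eps sigma P t <->
  (forall a, a \in t -> P a) /\ (forall x, reflection_prod t x = x).
Proof.
move=> sgn1; split=> [[tP nodd tj]|[tP t1]].
  split=> //; apply/reflection_prod_eq1 => [a /tP/sgn1//|]; split=> // [|j].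
    by apply: lambda_sep => j; rewrite lambda_alt_sum; have [] := tj j.
  by rewrite dag_image_lambda; have [-> ->] := tj j; rewrite scale0r subr0.
have /reflection_prod_eq1[|nodd a0 tj] := t1; first by move=> a /tP/sgn1.
split=> // j; have e1 := lambda_alt_sum t (size t) j.
have l0 : lam j 0 = 0.
  have [lin _] := lambda_spec j; have := lin (-1) 0 0.
  by rewrite scaler0 addr0 scaleN1r addNr.
rewrite a0 l0 in e1; split=> //.
by have := tj j; rewrite dag_image_lambda -e1 scale0r subr0.
Qed.

(** * Comparison with the reflections of the lattice A *)

Lemma form_sgn a b : f a b = (2 * sgn a * sgn b)%:~R.
Proof.
rewrite -(formq_inq f_form) [in formq f (inq a)]inq_split -val_V0_proj formq_split.
by rewrite !intrM.
Qed.

(** The coroot pairing is an integer by [form_sgn], so [numq] returns it exactly. *)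
Lemma refl_latticeE a b : f b b = 2 ->
  refl_lattice f b a = a - b *~ (2 * sgn a * sgn b).
Proof.
move=> b2; rewrite /refl_lattice /pairing b2 /= mulrAC divff// mul1r form_sgn.
by rewrite numq_int.
Qed.

Lemma reflection_inq a b : f b b = 2 ->
  reflection b (inq a, 0) = (inq (refl_lattice f b a), 0).
Proof.
move=> b2; rewrite refl_latticeE// /reflection copairing_inq form_sgn raddfB raddfMz.
change ((inq a - (2 * sgn a * sgn b)%:~R *: inq b, 0 - (2 * sgn a * sgn b)%:~R *: 0) =
  (inq a - inq b *~ (2 * sgn a * sgn b), 0 : dag)).
by rewrite scaler_int scaler0 subr0.
Qed.

(** Reflections are isometries: both arguments are moved by w_b, and the correction terms cancel
    because (b, b) = 2. *)
Lemma copairing_reflection a b x : f b b = 2 ->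
  copairing (refl_lattice f b a) (reflection b x) = copairing a x.
Proof.
move=> b2; pose c y : {additive A -> rat} := HB.pack (copairing^~ y)
  (GRing.isZmodMorphism.Build _ _ _ (copairing_zmod y)).
have reflE d : copairing d (reflection b x) = copairing d x - copairing b x * f b d.
  by rewrite /reflection addrC -scaleNr copairing_linear copairing_inq addrC mulNr.
rewrite refl_latticeE// -[LHS]/(c _ _) raddfB raddfMz /= !reflE b2 -mulrzr -form_sgn.
by rewrite (form_sym f_form b); ring.
Qed.

(** * Generation by a reflectable set, and the isomorphism *)

Section Reflectable.
Variables (R Pi : set A).
Hypothesis R_sgn : forall a, R a -> radical f a \/ sgn a * sgn a = 1.
Hypothesis Pi_reflectable : reflectable f R Pi.

Lemma Pi_sgn a : Pi a -> sgn a * sgn a = 1.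
Proof. by have [PiR _] := Pi_reflectable => /PiR[/R_sgn[]]. Qed.

Lemma sgn_norm a : sgn a * sgn a = 1 -> f a a = 2.
Proof. by move=> a1; rewrite form_sgn -mulrA a1. Qed.

Lemma Pi_norm (a : Pi) : f (val a) (val a) = 2.
Proof. exact/sgn_norm/Pi_sgn/set_valP. Qed.

Definition Pi_reflection (a : Pi) : aut (Vtilde f sigma) := reflection_aut (Pi_norm a).

Definition word_aut (w : seq (Pi * bool)) : aut (Vtilde f sigma) := word_eval Pi_reflection w.

(** The g admitting such a lift form a subgroup containing the generators of W_Pi. The two
    properties are what conjugating a reflection by the lift requires. *)
Lemma weyl_lift g : weyl f Pi g -> exists w : seq (Pi * bool),
  (forall c, word_aut w (inq c, 0) = (inq (g c : A), 0)) /\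
  (forall c x, copairing (g c) (word_aut w x) = copairing c x).
Proof.
move=> gW; apply: (gW [set g : aut (zmodule A) | exists w : seq (Pi * bool),
  (forall c, word_aut w (inq c, 0) = (inq (g c : A), 0)) /\
  (forall c x, copairing (g c) (word_aut w x) = copairing c x)]).
split=> [|{gW}g [a Pia gE]] /=; last first.
  exists [:: (SigSub (mem_set Pia), false)]; have a2 := Pi_norm (SigSub (mem_set Pia)).
  split=> [c|c x]; rewrite gE /=; first exact: reflection_inq.
  exact: copairing_reflection.
split=> [|x y [u [u1 u2]] [v [v1 v2]]]; first by exists [::].
exists (u ++ word_inv v); rewrite /word_aut word_eval_cat word_eval_inv.
set gu := word_aut u in u1 u2 *; set gv := word_aut v in v1 v2 *.
have [yK yVK] := aut_invK y; have [gvK gvVK] := aut_invK gv.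
split=> [c|c z].
  rewrite -[LHS]/(gu (aut_inv gv _)) -[in RHS]/(x (aut_inv y c)) -u1.
  (* The inverse of the lift of y lifts the inverse of y: this is checked after applying [gv], which
     is injective. *)
  by congr (gu _); apply: (can_inj gvK); rewrite gvVK v1 yVK.
rewrite -[in LHS]/(x (aut_inv y c)) -[_ z in LHS]/(gu (aut_inv gv z)) u2.
by rewrite -v2 yVK gvVK.
Qed.

Lemma word_aut_reflection a : R a ->
  exists w, forall x, word_aut w x = refl_tilde eps (inq a, 0) x.
Proof.
move=> Ra; have [a0|nza] := pselect (radical f a).
  by exists [::] => x; rewrite refl_tilde_radical.
have [_ PiR] := Pi_reflectable.
have : nonisotropic f R a by split.
rewrite -PiR => -[g gW [b Pib gb]].
have [w [w1 w2]] := weyl_lift gW.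
pose y : Pi := SigSub (mem_set Pib).
(* Conjugate w_b by the lift of g, where a = g b. *)
exists (w ++ (y, false) :: word_inv w) => x.
rewrite /word_aut word_eval_cat /= word_eval_inv -/(word_aut w).
have [_ wVK] := aut_invK (word_aut w).
rewrite -[LHS]/(word_aut w (reflection b (aut_inv (word_aut w) x))).
have -> : reflection b (aut_inv (word_aut w) x) =
    (- copairing a x) *: (inq b, 0) + aut_inv (word_aut w) x.
  (* The lift is an isometry carrying b to a, hence (b, w^-1 x) = (a, x). *)
  have <- : copairing b (aut_inv (word_aut w) x) = copairing a x by rewrite -w2 wVK gb.
  by rewrite /reflection addrC scaleNr.
have [//|a1] := R_sgn Ra.
by rewrite aut_linear wVK w1 gb refl_tildeE ?sgn_norm// /reflection addrC scaleNr.
Qed.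

Lemma word_aut_positive (t : seq Pi) x :
  word_aut [seq (a, false) | a <- t] x = reflection_prod [seq val a | a <- t] x.
Proof.
elim: t => //= a t IH.
by rewrite -[LHS]/(reflection (val a) (word_aut [seq (a, false) | a <- t] x)) IH.
Qed.

Lemma hyper_alternating_word (t : seq Pi) :
  hyper_alternating f eps sigma Pi [seq val a | a <- t] <->
  word_aut [seq (a, false) | a <- t] = 1%g.
Proof.
split=> [/(hyper_alternatingP _ Pi_sgn)[_ t1]|t1].
  by apply: autP => x; rewrite word_aut_positive t1.
apply/(hyper_alternatingP _ Pi_sgn); split=> [_ /mapP[a _ ->]|x]; first exact: set_valP.
by rewrite -word_aut_positive t1.
Qed.

Lemma hyperbolic_weyl_group_isomorphic :
  isomorphic (hyperbolic_weyl_group f eps sigma R)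
             (hyper_alternating_presentation f eps sigma Pi).
Proof.
have PiR := Pi_reflectable.1.
apply: (@isomorphic_presented _ _ Pi_reflection) => [a|g [a Ra gE]|w].
- apply: sub_gen_smallest; exists (val a); first by have [] := PiR _ (set_valP a).
  by move=> x; rewrite refl_tildeE ?Pi_norm.
- have [w wE] := word_aut_reflection Ra; exists w.
  by apply: autP => x; rewrite gE -wE.
have relP r : (exists2 t : seq Pi, hyper_alternating f eps sigma Pi [seq val a | a <- t]
    & r = [seq (a, false) | a <- t]) -> word_aut r = 1%g.
  by move=> [t /hyper_alternating_word t1 ->].
split=> [w1|/word_eval_eq e]; last exact: e.
have pos : word_eq [set w : seq (Pi * bool) | exists2 t : seq Pi,
    hyper_alternating f eps sigma Pi [seq val a | a <- t] & w = [seq (a, false) | a <- t]]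
    w [seq (l.1, false) | l <- w].
  apply: word_eq_positive => a; exists [:: a; a] => //.
  (* The pair (a, a) is hyper-alternating because w_a is an involution. *)
  apply/hyper_alternating_word; apply: autP => x; rewrite word_aut_positive /=.
  exact/reflectionK/Pi_norm.
(* The positive form of w still acts trivially, so its letters form a hyper-alternating tuple and it
   is itself a relator. *)
apply: (word_eq_trans pos); apply: word_eq_rel; exists [seq l.1 | l <- w].
  apply/hyper_alternating_word; rewrite -map_comp -[RHS]w1; apply/esym.
  exact: (word_eval_eq relP pos).
by rewrite -map_comp.
Qed.

End Reflectable.

End Hyperbolic.

Theorem theorem3p8
  (A : zmodType) (f : A -> A -> rat) (R : set A)
  (A_torsion_free : torsion_free A) (f_form : psd_form f)
  (R_ars : affine_reflection_system f R)
  (R_irr : irreducible f R) (R_tame : tame f R) (R_A1 : type_A1 f R)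
  (eps : A) (S : set A) (epsS : A1_data f R eps S)
  (J : choiceType) (sigma : J -> A)
  (sigma_S : forall j : J, S (sigma j))
  (sigma_basis : is_basis (fun j : J => inq (sigma j)) (V0_set f))
  (Pi : set A) (Pi_reflectable : reflectable f R Pi) :
  isomorphic (hyperbolic_weyl_group f eps sigma R)
             (hyper_alternating_presentation f eps sigma Pi).
Proof.
have [RE [SR S0 _ _] epsA eps_free eps2] := epsS.
(* It remains to see that roots are radical or of sign 1 or -1: S + S and 0 + S are radical, while
   eps + S and -eps + S have these signs. *)
apply: hyperbolic_weyl_group_isomorphic => // a; rewrite RE => -[[s Ss [t St <-]]|].
  left; have [_ s0] := SR _ Ss; have [_ t0] := SR _ St; exact: radicalD.
have sgnP n s : S s -> sgn_part f eps (eps *~ n + s) = n.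
  move=> Ss; apply: sgn_partE => //; rewrite addrC addKr.
  by have [] := SR _ Ss.
move=> [b b_eps [s Ss <-]].
have s0 : radical f s by have [] := SR _ Ss.
case: b_eps => [[->|->]|->].
- by left; rewrite add0r.
- by right; rewrite -[eps]mulr1z sgnP.
- by right; rewrite -[- eps]mulrN1z sgnP.
Qed.
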